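(* Let $T$ be a tree with $n\ge 1$ vertices and let $\ell\ge n-1$ be an integer. Then the lattice polytope $P_\ell(T)$ has the integer decomposition property: for every integer $t\ge 1$ and every $w\in tP_\ell(T)\cap\mathbb{Z}^n$ there exist $x_1,\dots,x_t\in P_\ell(T)\cap\mathbb{Z}^n$ with $w=x_1+\cdots+x_t$.
   Context: Label the vertices $v_1,\dots,v_n$. A chip configuration on $T$ is a vector $c\in\mathbb{Z}_{\ge 0}^n$ ($c_i$ chips on $v_i$). The Laplacian $\Delta(T)$ has $\Delta_{ii}=\deg(v_i)$, $\Delta_{ij}=-1$ if $v_iv_j$ is an edge, $0$ otherwise. Firing $v_i$ from $c$ produces $c-\Delta(T)e_i$, legal if $c_i\ge\deg(v_i)$. A configuration $c$ is self-reachable on $T$ if some nonempty finite sequence of legal firings starting from $c$ ends at $c$. (Known: equivalently, $c$ has at least $m-1$ chips on every $m$-vertex subtree of $T$.) $S_\ell^{(T)}$ is the set of self-reachable configurations on $T$ with exactly $\ell$ chips, and $P_\ell(T)=\mathrm{conv}(S_\ell^{(T)})$; $tP=\{tx:x\in P\}$. *)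

(* Defs.v *)
From HB Require Import structures.
From mathcomp Require Import all_boot all_order all_algebra.
From mathcomp Require Import classical_sets reals.

Set Implicit Arguments.
Unset Strict Implicit.
Unset Printing Implicit Defensive.

Import Order.TTheory GRing.Theory Num.Theory.

Local Open Scope classical_set_scope.
Local Open Scope ring_scope.

(* [ucycle e s] also holds for s = [:: x; y] when xy is an edge, so that graph
   cycles are the [ucycle]s of size at least 3. *)
Definition is_tree (V : finType) (e : rel V) : Prop :=
  [/\ symmetric e,
      irreflexive e,
      forall x y, connect e x y
    & forall s : seq V, ucycle e s -> (size s < 3)%N].

Section ChipFiring.
Variables (n : nat) (e : rel 'I_n).

Definition degree (i : 'I_n) : nat := #|[set j | e i j]%SET|.

Definition laplacian : 'M[int]_n :=
  \matrix_(i, j) if i == j then (degree i)%:Z else if e i j then -1 else 0.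

Definition chip_configuration (c : 'cV[int]_n) : Prop := forall i, 0 <= c i 0.

Definition fire (c : 'cV[int]_n) (i : 'I_n) : 'cV[int]_n :=
  c - laplacian *m delta_mx i 0.

Definition legal_firing : rel 'cV[int]_n := fun c c' =>
  [exists i, ((degree i)%:Z <= c i 0) && (c' == fire c i)].

(* [s] lists the configurations obtained after each firing. *)
Definition self_reachable (c : 'cV[int]_n) : Prop :=
  exists s : seq 'cV[int]_n, [/\ s != [::], path legal_firing c s & last c s = c].

Definition self_reachable_set (l : int) : set 'cV[int]_n :=
  [set c | [/\ chip_configuration c, self_reachable c & \sum_i c i 0 = l]].

End ChipFiring.

Section Polytopes.
Variables (R : realType) (n : nat).

Definition convex_hull (A : set 'cV[R]_n) : set 'cV[R]_n :=
  [set x | exists (m : nat) (a : 'I_m -> R) (p : 'I_m -> 'cV[R]_n),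
     [/\ forall i, 0 <= a i, \sum_i a i = 1, forall i, A (p i)
       & x = \sum_i a i *: p i]].

Definition dilate (t : nat) (P : set 'cV[R]_n) : set 'cV[R]_n :=
  [set t%:R *: x | x in P].

Definition embed (z : 'cV[int]_n) : 'cV[R]_n := map_mx intr z.

Definition lattice : set 'cV[R]_n := range embed.

Definition integer_decomposition_property (P : set 'cV[R]_n) : Prop :=
  forall (t : nat) (w : 'cV[R]_n),
    (1 <= t)%N -> (dilate t P `&` lattice) w ->
    exists x : 'I_t -> 'cV[R]_n,
      (forall i, (P `&` lattice) (x i)) /\ w = \sum_i x i.

Definition self_reachable_polytope (e : rel 'I_n) (l : int) : set 'cV[R]_n :=
  convex_hull [set embed c | c in self_reachable_set e l].

End Polytopes.

Arguments self_reachable_polytope R {n} e l.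

(* Main.v *)
(* A configuration c on a tree is self-reachable iff c dominates the indegree
   vector of some orientation: orient each edge to the endpoint whose
   last firing is earlier; conversely, fire all vertices once along a linear extension of the
   orientation. Hence a point w of t P_l(T) dominates a fractional assignment
   of t units to the endpoints of each edge. If w is integral, rounding the
   share of the child endpoint up and that of the parent endpoint down, for
   a root of T, keeps the assignment below w, since every vertex has at most one
   parent. The integral assignment splits into t orientations, and the surplus
   of w over the sum of their indegree vectors is distributed evenly. *)
Require Import Defs.
From mathcomp Require Import all_boot all_order all_algebra zify lra.
From mathcomp Require Import classical_sets reals.

Set Implicit Arguments.
Unset Strict Implicit.
Unset Printing Implicit Defensive.
Import Order.TTheory GRing.Theory Num.Theory.

(** * Elimination orders of a tree *)

Section EliminationOrder.
Variables (V : finType) (e : rel V).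

(** When [s] enumerates a tree, it removes leaves one after another: the neighbour of [v] in [s2],
    if any, is the parent of [v] for the last vertex taken as root. *)
Definition elimination_order (s : seq V) : Prop :=
  forall s1 v s2, s = s1 ++ v :: s2 ->
  {in s2 &, forall x y, e v x -> e v y -> x = y}.

Hypotheses (e_sym : symmetric e) (e_irr : irreflexive e).
Hypothesis acyclic : forall s : seq V, ucycle e s -> (size s < 3)%N.

(** The path grows at its head [x] inside [S], and [m] bounds the steps left. Once it is stuck, all
    neighbours of [x] in [S] lie on the path, and any besides [head x p] would close a cycle of
    length at least 3, so [x] is a leaf of [S]. *)
Lemma path_extends_to_leaf (S : {set V}) m x p :
  (#|V| - size p <= m)%N -> path e x p -> uniq (x :: p) ->
  {subset x :: p <= S} ->
  exists2 v, v \in S & {in S &, forall y z, e v y -> e v z -> y = z}.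
Proof.
elim: m x p => [|m IH] x p hm hp hu hS.
  move: hm; rewrite leqn0 subn_eq0 => hm.
  by have := leq_trans (max_card (mem (x :: p))) hm; rewrite (card_uniqP hu) /= ltnn.
have [/existsP[y /and3P[yS exy yp]]|] :=
  boolP [exists y, [&& y \in S, e x y & y \notin x :: p]].
  apply: (IH y (x :: p)) => [||| z]; rewrite ?inE.
  - by move: hm => /=; lia.
  - by rewrite /= e_sym exy.
  - by rewrite cons_uniq yp hu.
  - by case/predU1P => [->//|zp]; apply: hS; rewrite inE.
move/existsPn => noext; exists x; first by apply: hS; rewrite mem_head.
have nbr y : y \in S -> e x y -> y = head x p.
  move=> yS exy; have := noext y; rewrite yS exy /= negbK inE.
  case/predU1P => [yx|]; first by rewrite yx e_irr in exy.
  case: p hp hu {hm hS noext} => // a q hp hu; rewrite inE.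
  case/predU1P => //= /splitPr yq; case: yq hp hu => q1 q2 hp hu.
  suff /acyclic : ucycle e (x :: a :: rcons q1 y) by rewrite /= size_rcons.
  apply/andP; split.
    move: hp; rewrite /= cat_path /= => /and3P[-> hq1 /andP[hy _]].
    by rewrite !rcons_path hq1 hy /= last_rcons e_sym exy.
  by move: hu; rewrite -cat_rcons -!cat_cons cat_uniq => /andP[].
by move=> y z yS zS /(nbr _ yS) -> /(nbr _ zS) ->.
Qed.

Lemma elimination_order_exists :
  exists2 s, elimination_order s & uniq s /\ s =i V.
Proof.
suff H k (S : {set V}) : #|S| = k ->
    exists2 s, elimination_order s & uniq s /\ s =i S.
  have [s hs [us sS]] := H _ [set: V] erefl.
  by exists s => //; split=> // x; rewrite sS !inE.
elim: k S => [|k IH] S cS.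
  exists [::]; first by case=> [|? ?] ? ? [].
  by split=> // x; rewrite (cards0_eq cS) finset.in_set0.
have /card_gt0P[x xS] : (0 < #|S|)%N by rewrite cS.
have [|//|//||v vS leaf] := @path_extends_to_leaf S #|V| x [::].
- by rewrite leq_subr.
- by move=> y; rewrite inE => /eqP ->.
have [|s hs [us sS]] := IH (S :\ v).
  by move: cS; rewrite (cardsD1 v) vS => -[].
exists (v :: s); last first.
  split=> [|y]; first by rewrite /= us sS !inE eqxx.
  by rewrite inE sS !inE; case: eqVneq => // ->; rewrite vS.
case=> [|u s1] w s2 []; last by move=> _; apply: hs.
move=> <- <- y z; rewrite !sS !inE => /andP[_ yS] /andP[_ zS]; exact: leaf.
Qed.

End EliminationOrder.

(** * Orientations, their indegrees and linear extensions *)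

Section Orientation.
Variables (V : finType) (e : rel V).

(* [o x y] means that the edge xy points to y. *)
Definition orientation (o : rel V) : Prop :=
  forall x y, (o x y + o y x = e x y)%N.

Definition indegree (o : rel V) (v : V) : nat := (\sum_u o u v)%N.

(** Mirrors the firing of [v]: being now the most recently fired endpoint of all its edges, [v]
    becomes a source. *)
Definition reorient (o : rel V) (v : V) : rel V :=
  fun x y => if y == v then false else if x == v then e x y else o x y.

Hypotheses (e_sym : symmetric e) (e_irr : irreflexive e).

Lemma orientation_reorient o v : orientation o -> orientation (reorient o v).
Proof.
move=> ho x y; rewrite /reorient.
by case: (eqVneq x v) (eqVneq y v) => [->|xv] [->|yv] //;
   rewrite ?e_irr ?addn0 // e_sym.
Qed.

Lemma orientation_exists : exists o, orientation o.
Proof.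
exists (fun x y => e x y && (enum_rank x < enum_rank y)%N) => x y.
rewrite [e y x]e_sym; case exy: (e x y) => //=.
case: ltngtP => // /ord_inj/enum_rank_inj xy.
by rewrite xy e_irr in exy.
Qed.

Lemma indegree_reorient_self o v : indegree (reorient o v) v = 0%N.
Proof. by apply: big1 => u _; rewrite /reorient eqxx. Qed.

Lemma indegree_reorient_le o v u : orientation o -> u != v ->
  (indegree (reorient o v) u <= indegree o u + e u v)%N.
Proof.
move=> ho uv; rewrite /indegree (bigD1 v) //= [X in (_ <= X + _)%N](bigD1 v) //=.
rewrite /reorient (negPf uv) eqxx [e u v]e_sym addnAC leq_add //; first lia.
by apply: leq_sum => x /negPf ->.
Qed.

(** Double counting of the edges; it shows that all orientations have the same total indegree
    without computing the number of edges. *)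
Lemma sum_indegree o : orientation o ->
  (2 * \sum_v indegree o v = \sum_u \sum_v e u v)%N.
Proof.
move=> ho; rewrite mul2n -addnn {1}exchange_big -big_split /=.
by apply: eq_bigr => u _; rewrite -big_split; apply: eq_bigr => v _; apply: ho.
Qed.

(* A vertex is put first or last according to the direction of the edge to its
   only later neighbour in the elimination order. *)
Lemma linear_extension o s : orientation o -> elimination_order e s ->
  exists2 L, perm_eq L s & pairwise (fun x y => ~~ o x y) L.
Proof.
move=> ho; elim: s => [|v s IH] hs; first by exists [::].
have [|L Ls pL] := IH.
  by move=> s1 u s2 su; apply: (hs (v :: s1) u s2); rewrite su.
have oe x y : o x y -> e x y by have := ho x y; case: (o x y); case: (e x y).
have hL := perm_mem Ls.
have [/hasP[p ps ovp]|/hasPn nov] := boolP (has (o v) s).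
  exists (rcons L v); first by rewrite perm_rcons perm_cons.
  rewrite pairwise_rcons pL andbT; apply/allP => x; rewrite hL => xs.
  apply/negP => oxv; have xp : x = p.
    by apply: (hs [::] v s) => //; rewrite ?(oe v p ovp) // e_sym (oe _ _ oxv).
  by have := ho v p; rewrite ovp -{1}xp oxv; case: (e v p).
exists (v :: L); first by rewrite perm_cons.
by rewrite /= pL andbT; apply/allP => x; rewrite hL => /nov.
Qed.

End Orientation.

(** * Splitting a vector of naturals into summands of equal total *)

Lemma sub_summand (V : finType) (D : V -> nat) m : (m <= \sum_v D v)%N ->
  exists2 X : V -> nat, \sum_v X v = m & forall v, (X v <= D v)%N.
Proof.
elim: m => [|m IH] hm; first by exists (fun=> 0%N); rewrite ?sum_nat_const ?muln0.
have [X sX XD] := IH (ltnW hm).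
have [/existsP[v hv]|/existsPn ge] := boolP [exists v, (X v < D v)%N].
  exists (fun u => X u + (u == v))%N => [|u]; last first.
    by case: eqVneq => [->|_]; rewrite ?addn1 ?addn0.
  rewrite big_split /= sX (bigD1 v) //= eqxx big1 ?addn0 ?addn1 //.
  by move=> u /negPf ->.
have : (\sum_v D v <= \sum_v X v)%N.
  by apply: leq_sum => v _; rewrite leqNgt ge.
by rewrite sX leqNgt hm.
Qed.

Lemma split_summands (V : finType) (D : V -> nat) t m :
  (\sum_v D v = t * m)%N ->
  exists X : nat -> V -> nat,
    (forall k, (k < t)%N -> (\sum_v X k v = m)%N) /\
    (forall v, (\sum_(k < t) X k v = D v)%N).
Proof.
elim: t D => [|t IH] D sD.
  exists (fun _ _ => 0%N); split=> // v; rewrite big_ord0.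
  by move/eqP: sD; rewrite sum_nat_eq0 => /forallP/(_ v)/eqP.
have [|Y sY YD] := @sub_summand V D m; first by rewrite sD mulSn leq_addr.
have [|X [sX XD]] := IH (fun v => D v - Y v)%N.
  by rewrite sumnB // sD sY mulSn addKn.
exists (fun k => if k is k'.+1 then X k' else Y); split=> [[|k] // /sX //|v].
by rewrite big_ord_recl /= XD subnKC.
Qed.

Local Open Scope ring_scope.

(** * Self-reachability in terms of orientations *)

Section SelfReachable.
Variables (n : nat) (e : rel 'I_n).
Hypotheses (e_sym : symmetric e) (e_irr : irreflexive e).

Lemma degreeE v : degree e v = (\sum_u e v u)%N.
Proof.
rewrite /degree -sum1_card big_mkcond.
by apply: eq_bigr => u _; rewrite inE; case: (e v u).
Qed.

Lemma fireE (c : 'cV[int]_n) v u : fire e c v u 0 =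
  if u == v then c u 0 - (degree e v)%:Z else c u 0 + (e u v)%:Z.
Proof.
rewrite /fire -colE !mxE; case: eqVneq => [->//|_].
by case: (e u v); rewrite ?opprK ?oppr0.
Qed.

Lemma indegree_le_fire o (c : 'cV[int]_n) v u : orientation e o -> u != v ->
  (indegree o u)%:Z <= c u 0 -> (indegree (reorient e o v) u)%:Z <= fire e c v u 0.
Proof.
by move=> ho uv hc; rewrite fireE (negPf uv);
   have := indegree_reorient_le e_sym ho uv; lia.
Qed.

(* Each edge is made to point to its endpoint whose last firing is earlier:
   since that firing the endpoint has received a chip along the edge. *)
Lemma orientation_of_firings (c : 'cV[int]_n) s :
  chip_configuration c -> path (legal_firing e) c s ->
  exists (F : {set 'I_n}) (o : rel 'I_n),
  [/\ orientation e o,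
      chip_configuration (last c s),
      s != [::] -> F != finset.set0,
      forall v, v \in F -> (indegree o v)%:Z <= last c s v 0
    & forall v, v \notin F ->
        c v 0 <= last c s v 0 /\
        forall u, u \in F -> e v u -> c v 0 < last c s v 0].
Proof.
move=> c0; elim/last_ind: s => [_|s d IH].
  have [o ho] := orientation_exists e_sym e_irr.
  by exists finset.set0, o; split=> // v; rewrite inE // => _; split=> // u; rewrite inE.
rewrite rcons_path last_rcons => /andP[/IH[F [o [ho d0 _ hF hnF]]]].
case/existsP=> v /andP[hv /eqP ->]; exists (v |: F), (reorient e o v); split.
- exact: orientation_reorient.
- by move=> u; rewrite fireE; case: eqVneq => [->|_]; have := d0 u; lia.
- by move=> _; apply/set0Pn; exists v; rewrite setU11.
- move=> u; rewrite in_setU1; case: (eqVneq u v) => [->|uv] /= => [_|uF].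
    by rewrite indegree_reorient_self fireE eqxx; lia.
  by apply: indegree_le_fire => //; apply: hF.
- move=> u; rewrite in_setU1 negb_or => /andP[uv uF].
  have [h1 h2] := hnF u uF; rewrite fireE (negPf uv); split; first lia.
  move=> x; rewrite in_setU1 => /predU1P[->|xF] eux; first by rewrite eux; lia.
  by have := h2 x xF eux; lia.
Qed.

(** The set [F] consists of the vertices that fired. A neighbour of [F] that never fired would end
    with more chips than it had, which is impossible on returning to [c]; so [F] is closed under
    adjacency and, by connectedness, contains every vertex. *)
Lemma orientation_of_self_reachable (c : 'cV[int]_n) :
  (forall x y, connect e x y) -> chip_configuration c -> self_reachable e c ->
  exists2 o, orientation e o & forall v, (indegree o v)%:Z <= c v 0.
Proof.
move=> conn c0 [s [s0 ps sc]].
have [F [o [ho _ hF0 hF hnF]]] := orientation_of_firings c0 ps.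
rewrite sc in hF hnF; exists o => // v; apply: hF.
have [x xF] := set0Pn _ (hF0 s0).
suff clF : closed e [in F] by rewrite -[v \in F](closed_connect clF (conn x v)).
apply: intro_closed => [|y z eyz yF]; first exact: sym_connect_sym.
apply: contraT => zF; have [_ /(_ y yF)] := hnF z zF.
by rewrite e_sym eyz ltxx => /(_ isT).
Qed.

(** The head [v] of [L] is a sink, so its indegree is its degree and firing it is legal. The firing
    turns [v] into a source, and all the hypotheses pass to the tail with the reoriented edges. *)
Lemma fire_in_order (L : seq 'I_n) o (c : 'cV[int]_n) :
  orientation e o -> (forall v, (indegree o v)%:Z <= c v 0) ->
  uniq L -> pairwise (fun x y => ~~ o x y) L ->
  (forall x y, x \in L -> y \notin L -> ~~ o x y) ->
  exists s, [/\ size s = size L, path (legal_firing e) c s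
    & last c s = c - \sum_(v <- L) laplacian e *m delta_mx v 0].
Proof.
elim: L o c => [|v L IH] o c ho hc /=.
  by exists [::]; rewrite big_nil subr0.
move=> /andP[vL uL] /andP[/allP ov pL] clL.
have nov x : o v x = false.
  apply/negbTE; case: (boolP (x \in v :: L)) => [|xL]; last first.
    by apply: clL; rewrite // mem_head.
  rewrite inE => /predU1P[->|/ov//].
  by have := ho v v; rewrite e_irr; case: (o v v).
have legal : (degree e v)%:Z <= c v 0.
  apply: le_trans (hc v); rewrite degreeE lez_nat; apply: leq_sum => u _.
  by rewrite -(ho v u) nov.
have neqv x : x \in L -> (x == v) = false by move=> xL; apply: contraNF vL => /eqP <-.
have [||//||x y xL yL|s [ss ps ls]] := IH (reorient e o v) (fire e c v).
- exact: orientation_reorient.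
- move=> u; have [->|uv] := eqVneq u v; last exact: indegree_le_fire.
  by rewrite indegree_reorient_self fireE eqxx; lia.
- apply: (sub_in_pairwise (P := mem L)) pL; last exact/allP.
  move=> x y xL yL.
  by rewrite /reorient (neqv x xL) (neqv y yL).
- rewrite /reorient (neqv x xL); case: eqVneq => // yv.
  by apply: clL; rewrite inE ?xL ?orbT // negb_or yv.
exists (fire e c v :: s); rewrite /= ss ps ls big_cons /fire opprD addrA; split=> //.
by rewrite andbT; apply/existsP; exists v; rewrite legal eqxx.
Qed.

(** This is why firing every vertex once restores the configuration. *)
Lemma laplacian_row_sum i : \sum_j laplacian e i j = 0.
Proof.
rewrite (bigD1 i) //= !mxE eqxx degreeE (bigD1 i) //= e_irr add0n.
rewrite (big_morph Posz PoszD erefl) -big_split big1 //= => j ji.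
by rewrite !mxE eq_sym (negPf ji); case: (e i j).
Qed.

Lemma self_reachable_of_orientation s o (c : 'cV[int]_n) :
  (0 < n)%N -> elimination_order e s -> uniq s -> s =i 'I_n ->
  orientation e o -> (forall v, (indegree o v)%:Z <= c v 0) ->
  self_reachable e c.
Proof.
move=> n0 hs us sV ho hc; have [L Ls pL] := linear_extension e_sym ho hs.
have LV x : x \in L by rewrite (perm_mem Ls) sV.
have uL : uniq L by rewrite (perm_uniq Ls).
have clL x y : x \in L -> y \notin L -> ~~ o x y by rewrite [y \in L]LV.
have [r [sr pr lr]] := fire_in_order ho hc uL pL clL.
exists r; split=> //.
  rewrite -size_eq0 sr -lt0n; case: L LV {Ls pL lr sr uL clL} => //.
  by move/(_ (Ordinal n0)); rewrite in_nil.
rewrite lr; apply/colP => i; rewrite !mxE summxE.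
transitivity (c i 0 - \sum_j laplacian e i j); last by rewrite laplacian_row_sum subr0.
congr (_ - _).
rewrite (perm_big (index_enum 'I_n)) /=; last first.
  by apply: uniq_perm => // [|x]; rewrite ?index_enum_uniq // mem_index_enum LV.
by apply: eq_bigr => v _; rewrite -colE mxE.
Qed.

End SelfReachable.

(** * Rounding a fractional assignment *)

Section Rounding.
Variables (R : realType) (V : finType).

(** At most one term is rounded up. It is bounded by [w] minus the floors of the others, and this
    bound is an integer, so its ceiling obeys it too. *)
Lemma round_sum_le (g : V -> R) (up : pred V) (w : int) :
  (forall x y, up x -> up y -> x = y) -> \sum_u g u <= w%:~R ->
  \sum_u (if up u then Num.ceil (g u) else Num.floor (g u)) <= w.
Proof.
move=> up1; case: (pickP up) => [p hp|noup] gw; last first.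
  rewrite -(ler_int R); apply: le_trans gw; rewrite rmorph_sum ler_sum // => u _.
  by rewrite noup floor_le.
rewrite (bigD1 p) //= hp -lerBrDr ceil_le_int rmorphB lerBrDr.
apply: le_trans gw; rewrite [X in _ <= X](bigD1 p) //= lerD2l rmorph_sum.
apply: ler_sum => u up_neq; case: ifP => [/up1/(_ hp) eup|_]; last exact: floor_le.
by rewrite eup eqxx in up_neq.
Qed.

(** The left side is an integer strictly between [t - 1] and [t + 1]. *)
Lemma ceilD_floor (x y : R) (t : nat) : x + y = t%:R ->
  Num.ceil x + Num.floor y = t%:Z.
Proof.
move=> xy; have := ceil_itv x; have := floor_itv y.
rewrite !intrD => /andP[y1 y2] /andP[x1 x2].
apply/eqP; rewrite eq_le -!ltzD1 -!(ltr_int R) !intrD -pmulrn; lra.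
Qed.

Variables (e : rel V) (s : seq V).
Hypotheses (e_sym : symmetric e) (e_irr : irreflexive e).
Hypotheses (s_order : elimination_order e s) (s_uniq : uniq s) (sV : s =i V).

Lemma later_neighbour_unique v x y :
  e v x && (index v s < index x s)%N -> e v y && (index v s < index y s)%N ->
  x = y.
Proof.
have [s1 [s2 def_s]] : exists s1 s2, s = s1 ++ v :: s2.
  have : v \in s by rewrite sV.
  by case/splitPr => s1 s2; exists s1, s2.
have vs1 : v \notin s1.
  by move: s_uniq; rewrite def_s uniq_catC cons_uniq mem_cat negb_or => /andP[/andP[]].
have later z : e v z && (index v s < index z s)%N -> z \in s2.
  case/andP=> evz; have : z \in s by rewrite sV.
  rewrite def_s !index_cat (negPf vs1) mem_cat inE /= eqxx addn0.
  case: ifP => [zs1 _|_ /=]; first by rewrite ltnNge ltnW ?index_mem.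
  by case/predU1P => // zv; rewrite zv e_irr in evz.
move=> hx hy; apply: (s_order def_s); rewrite ?later //.
  by case/andP: hx.
by case/andP: hy.
Qed.

(* Round up towards the endpoint eliminated first, and down towards the other:
   then at most one of the weights pointing to a given vertex is rounded up. *)
Lemma round_assignment (f : V -> V -> R) (t : nat) (w : V -> int) :
  (forall x y, 0 <= f x y) ->
  (forall x y, f x y + f y x = (t * e x y)%:R) ->
  (forall v, \sum_u f u v <= (w v)%:~R) ->
  exists F : V -> V -> nat,
    (forall x y, F x y + F y x = t * e x y)%N /\
    (forall v, (\sum_u F u v)%:Z <= w v).
Proof.
move=> f0 fe fw; pose up v u := e v u && (index v s < index u s)%N.
pose G u v := if up v u then Num.ceil (f u v) else Num.floor (f u v).
have G0 u v : 0 <= G u v.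
  rewrite /G; case: ifP => _; last by rewrite floor_ge0.
  by rewrite ceil_ge0; apply: lt_le_trans (f0 u v); rewrite ltrN10.
exists (fun u v => `|G u v|%N); split=> [x y|v]; last first.
  rewrite (big_morph Posz PoszD erefl).
  rewrite (eq_bigr (G ^~ v)) => [|u _]; last by rewrite gez0_abs.
  by apply: round_sum_le (fw v) => x y; apply: later_neighbour_unique.
apply/eqP; rewrite -eqz_nat PoszD !gez0_abs //; apply/eqP.
rewrite /G /up [e y x]e_sym; case exy: (e x y) (fe x y) => /=; rewrite ?muln1 ?muln0 => fxy.
  case: ltngtP => [xy|xy|xy].
  - exact: ceilD_floor.
  - by rewrite addrC; apply: ceilD_floor; rewrite addrC.
  - have yx : y = x by apply: (index_inj x _ _ xy); rewrite sV.
    by rewrite yx e_irr in exy.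
have := f0 x y; have := f0 y x => h1 h2.
have -> : f x y = 0 by lra.
have -> : f y x = 0 by lra.
by rewrite floor0.
Qed.

End Rounding.

(** * Splitting an integral assignment into orientations *)

Lemma sum_ltn_ord t m : (\sum_(k < t) (k < m) = minn t m)%N.
Proof.
elim: t => [|t IH]; first by rewrite big_ord0 min0n.
by rewrite big_ord_recr /= IH; lia.
Qed.

(** For an edge with lower-ranked endpoint [x], the first [F x y] orientations point it to [y] and
    the remaining [t - F x y = F y x] point it to [x]. *)
Lemma split_assignment (V : finType) (e : rel V) (F : V -> V -> nat) t :
  symmetric e -> irreflexive e ->
  (forall x y, F x y + F y x = t * e x y)%N ->
  exists o : nat -> rel V, (forall k, orientation e (o k)) /\
    (forall x y, \sum_(k < t) o k x y = F x y)%N.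
Proof.
move=> e_sym e_irr hF.
exists (fun k x y => e x y && if (enum_rank x < enum_rank y)%N then (k < F x y)%N
                              else ~~ (k < F y x)%N).
have tri x y : e x y -> (enum_rank x < enum_rank y)%N = ~~ (enum_rank y < enum_rank x)%N.
  by case: ltngtP => // /ord_inj/enum_rank_inj ->; rewrite e_irr.
split=> [k x y|x y].
  rewrite [e y x]e_sym; case exy: (e x y) => //=.
  by rewrite (tri x y exy); case: (_ < enum_rank x)%N => /=; case: (k < _)%N.
have := hF x y; case exy: (e x y) => /= Fxy; last first.
  by rewrite big1 //; lia.
case: (_ < enum_rank y)%N => /=; first by rewrite sum_ltn_ord; lia.
have : (\sum_(k < t) ~~ (k < F y x) + \sum_(k < t) (k < F y x) = t)%N.
  rewrite -big_split -[RHS]card_ord -sum1_card; apply: eq_bigr => k _ /=.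
  by case: (k < F y x)%N.
by rewrite sum_ltn_ord => h; apply: (@addIn (minn t (F y x))); rewrite h; lia.
Qed.

Lemma mem_convex_hull (R : realType) n (A : set 'cV[R]_n) x :
  A x -> convex_hull A x.
Proof.
move=> Ax; exists 1%N, (fun=> 1), (fun=> x).
by split=> //; rewrite big_ord1 ?scale1r.
Qed.

Theorem theorem4p1 (R : realType) (n : nat) (hn : (1 <= n)%N)
    (T : rel 'I_n) (hT : is_tree T) (l : int) (hl : n%:Z - 1 <= l) :
  integer_decomposition_property (self_reachable_polytope R T l).
Proof.
have [T_sym T_irr T_conn T_acyc] := hT.
have [s s_order [s_uniq sT]] := elimination_order_exists T_sym T_irr T_acyc.
move=> t _ t1 [[_ [m [a [p [a0 a1 hp ->]]]] <-] [z _ hz]].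
have /fin_all_exists[c hc] (i : 'I_m) :
    exists ci, self_reachable_set T l ci /\ embed R ci = p i.
  by have [ci] := hp i; exists ci.
have /fin_all_exists[o ho] (i : 'I_m) :
    exists oi, orientation T oi /\ forall v, (indegree oi v)%:Z <= c i v 0.
  have [[c0 ci _] _] := hc i.
  by have [oi] := orientation_of_self_reachable T_sym T_irr T_conn c0 ci; exists oi.
have zE v : (z v 0)%:~R = t%:R * \sum_i a i * (c i v 0)%:~R :> R.
  transitivity (embed R z v 0); first by rewrite mxE.
  rewrite hz mxE summxE; congr (_ * _); apply: eq_bigr => i _.
  by rewrite -(hc i).2 !mxE.
have sum_z : \sum_v z v 0 = t%:Z * l.
  apply: (@intr_inj R); rewrite rmorph_sum rmorphM /= -pmulrn.
  rewrite (eq_bigr _ (fun v _ => zE v)).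
  rewrite -mulr_sumr exchange_big /=; congr (_ * _).
  rewrite -[RHS]mul1r -[X in _ = X * _]a1 mulr_suml; apply: eq_bigr => i _.
  by have [[_ _ <-] _] := hc i; rewrite rmorph_sum mulr_sumr.
(* The convex combination of the points carries over to their orientations; scaled by [t], it
   assigns [t] units to each edge and is dominated by [z]. *)
pose f u v : R := t%:R * \sum_i a i * (o i u v)%:R.
have [|x y|v|F [FT Fz]] := round_assignment T_sym T_irr s_order s_uniq sT
  (f := f) (t := t) (w := z^~ 0).
- by move=> x y; rewrite mulr_ge0 // sumr_ge0 // => i _; rewrite mulr_ge0.
- rewrite /f -mulrDr natrM -big_split /=; congr (_ * _).
  rewrite -[RHS]mul1r -[X in _ = X * _]a1 mulr_suml; apply: eq_bigr => i _.
  by rewrite -mulrDr -natrD (ho i).1.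
- rewrite zE -mulr_sumr ler_wpM2l // exchange_big ler_sum //= => i _.
  rewrite -mulr_sumr ler_wpM2l // -natr_sum pmulrn ler_int; exact: (ho i).2.
have [ok [hok okF]] := split_assignment T_sym T_irr FT.
(* As the coefficients sum to 1, some point exists. Its orientation gives the common total indegree
   [E], and dominance gives [E <= l]. *)
have m0 : (0 < m)%N.
  by case: m a p a1 {a0 hp hz c hc o ho zE f} => // a p /eqP; rewrite big_ord0 eq_sym oner_eq0.
pose i0 := Ordinal m0; pose E := (\sum_v indegree (o i0) v)%N.
have EE o' : orientation T o' -> (\sum_v indegree o' v = E)%N.
  by move=> /sum_indegree h; have := sum_indegree (ho i0).1; rewrite -h -/E; lia.
have El : E%:Z <= l.
  have [[_ _ <-] _] := hc i0; rewrite /E (big_morph Posz PoszD erefl).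
  by apply: ler_sum => v _; apply: (ho i0).2.
have FE : (\sum_v \sum_u F u v = t * E)%N.
  rewrite (eq_bigr (fun v => \sum_(k < t) indegree (ok k) v)%N) => [|v _]; last first.
    by rewrite /indegree exchange_big; apply: eq_bigr => u _; rewrite okF.
  rewrite exchange_big (eq_bigr (fun=> E)) => [|k _]; last exact: EE.
  by rewrite sum_nat_const card_ord.
(* The surplus of [z] over the rounded assignment is nonnegative with total [t * (l - E)]. Each of
   the [t] orientations receives a share of total [l - E], which brings its chip count to [l]. *)
have [|X [sX XD]] := @split_summands _
  (fun v => `|(z v 0 - (\sum_u F u v)%:Z)%R|%N) t `|(l - E%:Z)%R|%N.
  apply/eqP; rewrite -eqz_nat (big_morph Posz PoszD erefl).
  rewrite (eq_bigr (fun v => z v 0 - (\sum_u F u v)%:Z)) => [|v _]; last first.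
    by rewrite gez0_abs // subr_ge0.
  by rewrite sumrB sum_z -(big_morph Posz PoszD erefl) FE !PoszM gez0_abs ?subr_ge0 // mulrBr.
pose x k : 'cV[int]_n := \col_v (indegree (ok k) v + X k v)%:Z.
exists (fun k => embed R (x k)); split=> [k|].
  split; last by exists (x k).
  apply: mem_convex_hull; exists (x k) => //; split.
  - by move=> v; rewrite mxE.
  - apply: (self_reachable_of_orientation T_sym T_irr hn s_order s_uniq sT (hok k)).
    by move=> v; rewrite mxE lez_nat leq_addr.
  - under eq_bigr do rewrite mxE.
    rewrite -(big_morph Posz PoszD erefl) big_split /= sX // EE // PoszD gez0_abs ?subr_ge0 //.
    by rewrite addrC subrK.
rewrite -hz; apply/colP => v; rewrite summxE !mxE.
under eq_bigr do rewrite !mxE.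
rewrite -[RHS]rmorph_sum; congr (_%:~R).
rewrite -(big_morph Posz PoszD erefl) big_split /= XD.
rewrite PoszD gez0_abs ?subr_ge0 // /indegree exchange_big /=.
by under eq_bigr do rewrite okF; rewrite addrC subrK.
Qed.
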